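(* Let $G$ be a cyclic group and $p$ be an odd prime. (a) If $|G|=2p$ then $M_1(\mathcal{B}(G))=10p^4-16p^2+20$ and $M_2(\mathcal{B}(G))=10p^4-20p^2+20$. (b) If $|G|=2p^2$ then $M_1(\mathcal{B}(G))=10p^8-20p^6+24p^4-20p^2+20$ and $M_2(\mathcal{B}(G))=10p^8-20p^6+20p^4-20p^2+20$. (c) If $|G|=4p$ then $M_1(\mathcal{B}(G))=154p^4-292p^2+308$ and $M_2(\mathcal{B}(G))=154p^4-308p^2+308$. (d) If $|G|=4p^2$ then $M_1(\mathcal{B}(G))=154p^8-308p^6+324p^4-308p^2+308$ and $M_2(\mathcal{B}(G))=154p^8-308p^6+308p^4-308p^2+308$. Further, in each of these cases, $\frac{M_{2}(\mathcal{B}(G))}{|e(\mathcal{B}(G))|} \geq \frac{M_{1}(\mathcal{B}(G))}{|V(\mathcal{B}(G))|}$.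
   Context: For a finite group $G$, $L(G)$ denotes the set of all subgroups of $G$. The subgroup generating bipartite graph $\mathcal{B}(G)$ is the simple undirected bipartite graph whose vertex set is the disjoint union $(G\times G)\sqcup L(G)$, where $(a,b)\in G\times G$ and $H\in L(G)$ are adjacent if and only if $H=\langle a,b\rangle$ (the subgroup generated by $a$ and $b$); there are no other edges. For a finite simple graph $\mathcal{G}$ with vertex set $V(\mathcal{G})$ and edge set $e(\mathcal{G})$, the first and second Zagreb indices are $M_1(\mathcal{G})=\sum_{v\in V(\mathcal{G})}\deg(v)^2$ and $M_2(\mathcal{G})=\sum_{uv\in e(\mathcal{G})}\deg(u)\deg(v)$. *)

(* Defs.v *)
From mathcomp Require Import all_boot all_order all_algebra all_fingroup all_solvable.

Set Implicit Arguments.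
Unset Strict Implicit.
Unset Printing Implicit Defensive.

Record sgraph := SGraph {
  vertex :> finType;
  adj : rel vertex;
  adj_sym : symmetric adj;
  adj_irrefl : irreflexive adj
}.

Definition deg (X : sgraph) (v : X) : nat := #|[set w | adj v w]|.

(* Undirected edges: each edge uv is the two-element set {u, v}. *)
Definition edges (X : sgraph) : {set {set X}} :=
  [set [set u; v] | u in X, v in X & adj u v].

Definition zagreb1 (X : sgraph) : nat := \sum_(v : X) deg v ^ 2.

(* Irreflexivity makes every edge a set with exactly two elements u and v, so
   the inner product is deg u * deg v. *)
Definition zagreb2 (X : sgraph) : nat :=
  \sum_(uv in edges X) \prod_(v in uv) deg v.

Section SubgroupGeneratingGraph.

Variables (gT : finGroupType) (G : {group gT}).

Definition sgb_vertex : finType :=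
  ((subg_of G * subg_of G) + {H : {group gT} | H \subset G})%type.

Definition sgb_adj (u v : sgb_vertex) : bool :=
  match u, v with
  | inl (a, b), inr H | inr H, inl (a, b) =>
      sval H :==: <<[set sgval a; sgval b]>>%g
  | _, _ => false
  end.

Lemma sgb_adj_sym : symmetric sgb_adj.
Proof. by move=> [[a b]|H] [[c d]|K]. Qed.

Lemma sgb_adj_irrefl : irreflexive sgb_adj.
Proof. by move=> [[a b]|H]. Qed.

Definition subgroup_generating_graph : sgraph :=
  SGraph sgb_adj_sym sgb_adj_irrefl.

End SubgroupGeneratingGraph.

(* Main.v *)
Require Import Defs.
From mathcomp Require Import all_boot all_order all_algebra all_fingroup all_solvable.
From mathcomp Require Import zify ring.

(** Every pair (a, b) has exactly one neighbour in the graph, namely <<a, b>>,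
so its degree is 1, and the degree of a subgroup H is the number f(H) of pairs
generating it.  Sorting the pairs by the subgroup they generate gives
[\sum_H f(H) = #|G|^2], which is also the number of edges, and
[M2 = \sum_H f(H)^2], [M1 = #|G|^2 + M2] ([zagreb2E], [zagreb1E]).

With n = #|G| and k subgroups, the inequality M2 / n^2 >= M1 / (n^2 + k)
clears to n^4 <= k * \sum_H f(H)^2, which is Cauchy-Schwarz for f against the
constant 1 ([zagreb_ratio_leq]).

When G is cyclic it has one subgroup for each divisor d of n, so f(H) depends
only on the order d of H; call it F(d).  The pairs generating a subgroup whose
order divides m are those with both entries in the subgroup of order m, hence
\sum_(d | m) F(d) = m^2 for each m dividing n
([pairs_of_order_divisor_sums]).  This characterizes Jordan's totient J_2: it
forces F(q^(k+1)) = q^(2k+2) - q^(2k) for q prime and makes F multiplicative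
([jordan_pfactor], [jordanM]).  For n = 2^a p^b the sum \sum_(d | n) F(d)^2
thus splits as a product of a sum over the powers of 2 and a sum over the
powers of p ([sum_sqr_jordan_pfactor2]).  For a prime q such a sum is
q^4 - 2 q^2 + 2 when the exponent is 1 and q^8 - 2 q^6 + 2 q^4 - 2 q^2 + 2 when it is 2, which for q = 2 are the
constants 10 and 154. *)

Import Order.TTheory GRing.Theory Num.Theory.

(** * Sums of squares and sums over divisors *)

(** Cauchy-Schwarz against the constant function 1, obtained by summing
2 f(i) f(j) <= f(i)^2 + f(j)^2 over all i and j. *)
Lemma sqr_sum_leq (T : finType) (f : T -> nat) :
  (\sum_i f i) ^ 2 <= #|T| * \sum_i f i ^ 2.
Proof.
rewrite -(leq_pmul2l (ltn0Sn 1)).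
have -> : 2 * (\sum_i f i) ^ 2 = \sum_i \sum_j 2 * (f i * f j).
  rewrite -mulnn big_distrlr /= big_distrr /=.
  by apply: eq_bigr => i _; rewrite big_distrr.
apply: (@leq_trans (\sum_i \sum_j (f i ^ 2 + f j ^ 2))).
  by apply: leq_sum => i _; apply: leq_sum => j _; rewrite nat_Cauchy.
under eq_bigr do rewrite big_split sum_nat_const /=.
rewrite big_split /= sum_nat_const -big_distrr /=.
by rewrite addnn -mul2n.
Qed.

Lemma perm_divisorsM (m n : nat) : 0 < m -> 0 < n -> coprime m n ->
  perm_eq (divisors (m * n)) [seq d * e | d <- divisors m, e <- divisors n].
Proof.
move=> m0 n0 cop; apply: uniq_perm; first exact: divisors_uniq.
  apply: allpairs_uniq; try exact: divisors_uniq.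
  (* d is recovered from d * e as its gcd with m *)
  have gcd_fst d e : d %| m -> e %| n -> gcdn m (d * e) = d.
    by move=> dm en; rewrite Gauss_gcdl ?(coprime_dvdr en) //; apply/gcdn_idPr.
  move=> _ _ /allpairsP[[d e] /= [dm en ->]] /allpairsP[[d' e'] /= [dm' en' ->]].
  rewrite -!dvdn_divisors // in dm en dm' en' * => /= E.
  have dd' : d = d' by rewrite -(gcd_fst d e) // E gcd_fst.
  move/eqP: E; rewrite dd' eqn_pmul2l ?(dvdn_gt0 m0) //.
  by move=> /eqP->.
move=> d; rewrite -dvdn_divisors ?muln_gt0 ?m0 //; apply/idP/allpairsP.
  move=> dmn; exists (gcdn d m, gcdn d n).
  rewrite /= -!dvdn_divisors ?dvdn_gcdr //; split=> //; apply/eqP.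
  rewrite eqn_dvd muln_gcdr dvdn_gcd dvdn_mull // muln_gcdl dvdn_gcd dvdn_mulr //.
  rewrite dmn -muln_gcdl -muln_gcdr Gauss_dvd ?dvdn_gcdl //.
  exact: coprime_dvdl (dvdn_gcdr _ _) (coprime_dvdr (dvdn_gcdr _ _) cop).
case=> -[a b] /= []; rewrite -!dvdn_divisors // => am bn ->; exact: dvdn_mul.
Qed.

Lemma sum_divisorsM (g : nat -> nat) (m n : nat) :
    0 < m -> 0 < n -> coprime m n ->
  \sum_(d <- divisors (m * n)) g d =
    \sum_(d <- divisors m) \sum_(e <- divisors n) g (d * e).
Proof.
move=> m0 n0 cop.
by rewrite (perm_big _ (perm_divisorsM _ _ m0 n0 cop)) big_allpairs_dep.
Qed.

Lemma sum_divisors_pfactor (g : nat -> nat) (p k : nat) : prime p ->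
  \sum_(d <- divisors (p ^ k)) g d = \sum_(i < k.+1) g (p ^ i).
Proof.
move=> p_pr; have p1 := prime_gt1 p_pr.
have pk0 : 0 < p ^ k by rewrite expn_gt0 ltnW.
rewrite (perm_big [seq p ^ i | i <- iota 0 k.+1]).
  by rewrite big_map -[iota _ _]/(index_iota 0 k.+1) big_mkord.
apply: uniq_perm; first exact: divisors_uniq.
  by rewrite map_inj_uniq ?iota_uniq //; apply: expnI.
move=> d; rewrite -dvdn_divisors //; apply/dvdn_pfactor/mapP => //.
  by case=> i ik ->; exists i => //; rewrite mem_iota.
by case=> i; rewrite mem_iota => ik ->; exists i.
Qed.

(** * Jordan's totient J_2 *)

(** The Gauss-type identity characterizing Jordan's totient J_2 on the divisors
of N.  It is restricted to these divisors because counting pairs inside a group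
of order N says nothing about other integers. *)
Definition square_divisor_sums (F : nat -> nat) (N : nat) : Prop :=
  forall m, m %| N -> \sum_(d <- divisors m) F d = m ^ 2.

Lemma jordan1 (F : nat -> nat) (N : nat) : square_divisor_sums F N -> F 1 = 1.
Proof. by move=> hF; rewrite -[RHS](hF 1) ?dvd1n // big_seq1. Qed.

(** The divisors of p^(k+1) are those of p^k and p^(k+1) itself, so subtracting
two consecutive divisor sums isolates the value. *)
Lemma jordan_pfactor (F : nat -> nat) (N p k : nat) :
    square_divisor_sums F N -> prime p -> p ^ k.+1 %| N ->
  F (p ^ k.+1) = (p ^ k.+1) ^ 2 - (p ^ k) ^ 2.
Proof.
move=> hF p_pr pkN.
have pkN' : p ^ k %| N by rewrite (dvdn_trans _ pkN) ?dvdn_exp2l.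
rewrite -(hF _ pkN) -(hF _ pkN') !sum_divisors_pfactor // [in X in X - _]big_ord_recr /=.
by rewrite addKn.
Qed.

(** Induction on m * n.  The double sums of F(d e) and of F(d) F(e) over d | m
and e | n are both (m n)^2, and by induction their terms agree except perhaps
at (d, e) = (m, n); so these last terms agree as well. *)
Lemma jordanM (F : nat -> nat) (N m n : nat) :
    square_divisor_sums F N -> 0 < N -> coprime m n -> m * n %| N ->
  F (m * n) = F m * F n.
Proof.
move=> hF N0; have [k] := ubnP (m * n); elim: k m n => // k IH m n mn_k cop mnN.
have /andP[m0 n0] : (0 < m) && (0 < n) by rewrite -muln_gt0 (dvdn_gt0 N0).
have mN : m %| N := dvdn_trans (dvdn_mulr _ (dvdnn _)) mnN.
have nN : n %| N := dvdn_trans (dvdn_mull _ (dvdnn _)) mnN.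
pose s := [seq (d, e) | d <- divisors m, e <- divisors n].
have us : uniq s by apply: allpairs_uniq; rewrite ?divisors_uniq // => -[? ?] [].
have mns : (m, n) \in s.
  by apply/allpairsP; exists (m, n); rewrite /= !divisors_id.
have : \sum_(x <- s) F (x.1 * x.2) = \sum_(x <- s) F x.1 * F x.2.
  rewrite !big_allpairs_dep /= -sum_divisorsM // hF // -big_distrlr /=.
  by rewrite !hF // expnMn.
rewrite !(big_rem _ mns) /=.
rewrite [X in _ + X = _](_ : _ = \sum_(x <- rem (m, n) s) F x.1 * F x.2).
  exact: addIn.
rewrite !big_seq; apply: eq_bigr => -[d e] /=.
rewrite mem_rem_uniq // inE => /andP[ne /allpairsP[[d' e'] /= [dm en [dd' ee']]]].
rewrite -dd' -ee' -!dvdn_divisors // in dm en.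
apply: IH.
- apply: (@leq_trans (m * n)) => //.
  rewrite ltn_neqAle dvdn_leq ?dvdn_mul ?muln_gt0 ?m0 // andbT.
  (* d <= m and e <= n with d * e = m * n leave only d = m and e = n *)
  apply: contra ne => /eqP E; have [dm' en'] := (dvdn_leq m0 dm, dvdn_leq n0 en).
  have d0 := dvdn_gt0 m0 dm; have e0 := dvdn_gt0 n0 en.
  apply/eqP; congr (_, _); nia.
- exact: coprime_dvdl dm (coprime_dvdr en cop).
- exact: dvdn_trans (dvdn_mul dm en) mnN.
Qed.

Lemma sum_sqr_jordan_pfactor2 (F : nat -> nat) (q p a b : nat) :
    square_divisor_sums F (q ^ a * p ^ b) -> prime q -> prime p -> q != p ->
  \sum_(d <- divisors (q ^ a * p ^ b)) F d ^ 2 =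
    (\sum_(i < a.+1) F (q ^ i) ^ 2) * (\sum_(j < b.+1) F (p ^ j) ^ 2).
Proof.
move=> hF q_pr p_pr qp; set N := q ^ a * p ^ b in hF *.
have N0 : 0 < N by rewrite muln_gt0 !expn_gt0 !prime_gt0.
have cop i j : coprime (q ^ i) (p ^ j).
  by rewrite coprimeXl // coprimeXr // prime_coprime // dvdn_prime2.
rewrite sum_divisorsM ?expn_gt0 ?prime_gt0 // sum_divisors_pfactor // big_distrlr /=.
apply: eq_bigr => i _; rewrite sum_divisors_pfactor //; apply: eq_bigr => j _.
rewrite (jordanM _ _ _ _ hF) ?expnMn //.
by rewrite dvdn_mul // dvdn_exp2l // -ltnS.
Qed.

(** * Degrees and Zagreb indices of the subgroup generating graph *)

Section GeneratingPairs.

Variables (gT : finGroupType) (G : {group gT}).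

Local Notation pairs := (subg_of G * subg_of G)%type.
Local Notation subgroups := {H : {group gT} | H \subset G}.
Local Notation B := (subgroup_generating_graph G).

Definition pair_span (x : pairs) : {group gT} :=
  <<[set sgval x.1; sgval x.2]>>%G.

Lemma pair_span_sub (H : {group gT}) (x : pairs) :
  (pair_span x \subset H) = (sgval x.1 \in H) && (sgval x.2 \in H).
Proof. by rewrite gen_subG subUset !sub1set. Qed.

Lemma pair_span_subG (x : pairs) : pair_span x \subset G.
Proof. by rewrite pair_span_sub !subgP. Qed.

Definition generated (x : pairs) : subgroups :=
  exist _ (pair_span x) (pair_span_subG x).

Definition generating_pairs (H : subgroups) : nat := #|[set x | generated x == H]|.

Lemma adj_generated (x : pairs) (H : subgroups) :
  adj (inl x : B) (inr H) = (generated x == H).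
Proof. by case: x => a b; rewrite eq_sym -!val_eqE. Qed.

Lemma deg_pair (x : pairs) : deg (inl x : B) = 1.
Proof.
rewrite /deg (_ : [set w | _] = [set inr (generated x)]) ?cards1 //.
apply/setP => -[y|H]; rewrite !inE; first by case: (x) => a b; apply/esym/eqP.
by rewrite adj_generated eq_sym.
Qed.

Lemma deg_subgroup (H : subgroups) : deg (inr H : B) = generating_pairs H.
Proof.
rewrite /deg /generating_pairs -(card_imset _ (@inl_inj pairs subgroups)).
apply: eq_card => -[x|K]; rewrite !inE.
  rewrite mem_imset; last exact: inl_inj.
  by rewrite inE -adj_generated adj_sym.
by apply/esym/imsetP => -[].
Qed.

(** <<a, b>> lies in H exactly when a and b do. *)
Lemma card_pairs_in (H : {group gT}) : H \subset G ->
  #|[set x : pairs | pair_span x \subset H]| = #|H| ^ 2.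
Proof.
move=> sHG; pose H' := [set s : subg_of G | sgval s \in H].
have H'H : #|H'| = #|H|.
  rewrite -(card_imset _ (@subg_inj _ G)); apply: eq_card => h.
  apply/imsetP/idP => [[s]|hH]; first by rewrite inE => sH ->.
  have hG := subsetP sHG _ hH.
  by exists (subg G h); rewrite ?inE subgK.
rewrite -mulnn -[in RHS]H'H -cardsX; apply: eq_card => -[a b].
by rewrite !inE pair_span_sub.
Qed.

Lemma card_pairs : #|{: pairs}| = #|G| ^ 2.
Proof.
by rewrite -(card_pairs_in G) //; apply: eq_card => x; rewrite !inE pair_span_subG.
Qed.

Lemma sum_generating_pairs : \sum_H generating_pairs H = #|G| ^ 2.
Proof.
rewrite -card_pairs -sum1_card (partition_big generated predT) //=.
by apply: eq_bigr => H _; rewrite sum1dep_card.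
Qed.

Lemma zagreb1E : zagreb1 B = #|G| ^ 2 + \sum_H generating_pairs H ^ 2.
Proof.
rewrite /zagreb1 big_sumType /=; congr (_ + _).
  by under eq_bigr do rewrite deg_pair; rewrite sum1_card card_pairs.
by apply: eq_bigr => H _; rewrite deg_subgroup.
Qed.

(** Pairs parametrize the edges: the pair vertex of an edge determines the edge. *)
Definition pair_edge (x : pairs) : {set B} := [set inl x; inr (generated x)].

Lemma pair_edge_inj : injective pair_edge.
Proof.
move=> x y E; have : (inl x : B) \in pair_edge y by rewrite -E set21.
by rewrite !inE => /orP[] /eqP // [].
Qed.

Lemma edgesE : edges B = [set pair_edge x | x in [set: pairs]].
Proof.
apply/setP => e; apply/imset2P/imsetP.
  case=> -[x|H] [y|K] _; rewrite inE andTb.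
  - by case: x => ? ?; case: y.
  - by rewrite adj_generated => /eqP<- ->; exists x.
  - by rewrite adj_sym adj_generated => /eqP<- ->; exists y; rewrite // /pair_edge setUC.
  - by [].
case=> x _ ->; exists (inl x) (inr (generated x)) => //.
by rewrite inE andTb adj_generated.
Qed.

Lemma card_edges : #|edges B| = #|G| ^ 2.
Proof. by rewrite edgesE card_imset ?cardsT ?card_pairs //; apply: pair_edge_inj. Qed.

(** The edge of a pair x contributes 1 * f(<<x>>), and f(H) pairs generate H. *)
Lemma zagreb2E : zagreb2 B = \sum_H generating_pairs H ^ 2.
Proof.
rewrite /zagreb2 edgesE big_imset /=; last by move=> x y _ _; apply: pair_edge_inj.
under eq_bigl do rewrite inE.
rewrite (partition_big generated predT) //=; apply: eq_bigr => H _.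
transitivity (\sum_(x | generated x == H) generating_pairs H).
  apply: eq_bigr => x /eqP xH; rewrite big_setU1 ?inE //= big_set1.
  by rewrite deg_pair deg_subgroup mul1n xH.
by rewrite sum_nat_const -cardsE mulnn.
Qed.

(** With n = #|G|^2 edges, k subgroups and S = M2, cross-multiplying
(n + S) / (n + k) <= S / n leaves n^2 <= k * S,
which is Cauchy-Schwarz because the f(H) add up to n. *)
Lemma zagreb_ratio_leq :
  ((zagreb1 B)%:R / #|B|%:R <= (zagreb2 B)%:R / #|edges B|%:R :> rat)%R.
Proof.
have G0 : 0 < #|G| ^ 2 by rewrite expn_gt0 cardG_gt0.
have CS := sqr_sum_leq _ generating_pairs; rewrite sum_generating_pairs in CS.
rewrite card_edges card_sum card_pairs zagreb1E zagreb2E.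
move: (#|G| ^ 2) (\sum_H _) (#|_|) G0 CS => n S k n0 CS.
rewrite ler_pdivrMr ?ltr0n ?addn_gt0 ?n0 // mulrAC ler_pdivlMr ?ltr0n //.
by rewrite -!natrM ler_nat; nia.
Qed.

(** * Pairs generating a subgroup of given order in a cyclic group *)

Definition pairs_of_order (d : nat) : nat := #|[set x | #|pair_span x| == d]|.

Hypothesis cycG : cyclic G.

(** In a cyclic group a subgroup is determined by its order. *)
Lemma generating_pairs_order (H : subgroups) :
  generating_pairs H = pairs_of_order #|val H|.
Proof.
apply: eq_card => x; rewrite !inE -val_eqE /=.
by rewrite -(eq_subG_cyclic cycG (pair_span_subG x) (valP H)).
Qed.

Lemma cyclic_subgroup_of_order (d : nat) : d %| #|G| ->
  exists2 H : {group gT}, H \subset G & #|H| = d.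
Proof.
case/cyclicP: cycG => a Ga; rewrite Ga -orderE => dG.
exists <[(a ^+ (#[a]%g %/ d))%g]>%G; first by rewrite cycleX.
by rewrite -[LHS]orderE orderXdiv ?dvdn_div // divnA // mulKn.
Qed.

Lemma sum_subgroups_order (g : nat -> nat) :
  \sum_(H : subgroups) g #|val H| = \sum_(d <- divisors #|G|) g d.
Proof.
rewrite -(big_map (fun H : subgroups => #|val H|) predT g).
apply/perm_big/uniq_perm; last 2 first.
- exact: divisors_uniq.
- move=> d; rewrite -dvdn_divisors //; apply/mapP/idP => [[H _ ->]|].
    exact: cardSg (valP H).
  case/cyclic_subgroup_of_order => H sHG <-.
  by exists (exist _ H sHG) => //; rewrite mem_index_enum.
rewrite map_inj_uniq ?index_enum_uniq // => H K /eqP.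
by rewrite -(eq_subG_cyclic cycG (valP H) (valP K)) => /eqP/group_inj/val_inj.
Qed.

(** With H the subgroup of order m, #|<<a, b>>| divides m exactly when
<<a, b>> is contained in H, so the sum counts the pairs with entries in H. *)
Lemma pairs_of_order_divisor_sums : square_divisor_sums pairs_of_order #|G|.
Proof.
move=> m mG; have [H sHG Hm] := cyclic_subgroup_of_order _ mG.
have m0 : 0 < m := dvdn_gt0 (cardG_gt0 G) mG.
transitivity #|[set x : pairs | pair_span x \subset H]|.
  rewrite /pairs_of_order; under eq_bigr do rewrite -sum1dep_card big_mkcond /=.
  rewrite exchange_big -sum1dep_card [RHS]big_mkcond /=; apply: eq_bigr => x _.
  rewrite -(cardSg_cyclic cycG (pair_span_subG x) sHG) Hm (dvdn_divisors _ m0).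
  rewrite -big_mkcond /= sum1_count (eq_count (fun d => eq_sym _ d)).
  by rewrite count_uniq_mem ?divisors_uniq //; case: (_ \in _).
by rewrite card_pairs_in // Hm.
Qed.

Lemma sum_generating_pairs_sqr_pfactor2 (q p a b : nat) :
    #|G| = q ^ a * p ^ b -> prime q -> prime p -> q != p ->
  \sum_H generating_pairs H ^ 2 =
    (\sum_(i < a.+1) pairs_of_order (q ^ i) ^ 2) *
    (\sum_(j < b.+1) pairs_of_order (p ^ j) ^ 2).
Proof.
move=> Gn q_pr p_pr qp; have hF := pairs_of_order_divisor_sums; rewrite Gn in hF.
rewrite -sum_sqr_jordan_pfactor2 // -Gn.
rewrite -(sum_subgroups_order (fun d => pairs_of_order d ^ 2)).
by apply: eq_bigr => H _; rewrite generating_pairs_order.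
Qed.

End GeneratingPairs.

(** * The closed formulas *)

Local Open Scope ring_scope.

Lemma jordan_pfactorZ (F : nat -> nat) (N p k : nat) :
    square_divisor_sums F N -> prime p -> (p ^ k.+1 %| N)%N ->
  (F (p ^ k.+1)%N)%:Z = p%:Z ^+ (k.+1 * 2) - p%:Z ^+ (k * 2).
Proof.
move=> hF p_pr pkN; rewrite (jordan_pfactor _ _ _ _ hF) // -!expnM.
by rewrite -!natz natrB ?natrX // leq_exp2l ?prime_gt1 // leq_mul.
Qed.

Lemma sum_sqr_jordan_prime (F : nat -> nat) (N p : nat) :
    square_divisor_sums F N -> prime p -> (p %| N)%N ->
  (\sum_(i < 2) F (p ^ i) ^ 2)%N%:Z = p%:Z ^+ 4 - 2 * p%:Z ^+ 2 + 2.
Proof.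
move=> hF p_pr pN; have Fp := jordan_pfactorZ _ _ p 0 hF p_pr pN.
rewrite !big_ord_recr big_ord0 /= expn0 (jordan1 _ _ hF).
rewrite -natz natrD !natrX !natz Fp; ring.
Qed.

Lemma sum_sqr_jordan_prime_sqr (F : nat -> nat) (N p : nat) :
    square_divisor_sums F N -> prime p -> (p ^ 2 %| N)%N ->
  (\sum_(i < 3) F (p ^ i) ^ 2)%N%:Z =
    p%:Z ^+ 8 - 2 * p%:Z ^+ 6 + 2 * p%:Z ^+ 4 - 2 * p%:Z ^+ 2 + 2.
Proof.
move=> hF p_pr p2N.
have pN : (p %| N)%N := dvdn_trans (dvdn_exp2l p (isT : 1 <= 2)%N) p2N.
rewrite big_ord_recr -natz natrD natz (sum_sqr_jordan_prime _ _ _ hF) //=.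
by rewrite natrX !natz (jordan_pfactorZ _ _ p 1 hF p_pr p2N); ring.
Qed.

Theorem theorem3p4 (gT : finGroupType) (G : {group gT}) (p : nat)
    (cycG : cyclic G) (p_prime : prime p) (p_odd : odd p) :
  let B := subgroup_generating_graph G in
  let M1 := (zagreb1 B)%:Z in
  let M2 := (zagreb2 B)%:Z in
  let P := p%:Z in
  [/\ #|G| = (2 * p)%N ->
        M1 = 10 * P ^+ 4 - 16 * P ^+ 2 + 20 /\
        M2 = 10 * P ^+ 4 - 20 * P ^+ 2 + 20,
      #|G| = (2 * p ^ 2)%N ->
        M1 = 10 * P ^+ 8 - 20 * P ^+ 6 + 24 * P ^+ 4 - 20 * P ^+ 2 + 20 /\
        M2 = 10 * P ^+ 8 - 20 * P ^+ 6 + 20 * P ^+ 4 - 20 * P ^+ 2 + 20,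
      #|G| = (4 * p)%N ->
        M1 = 154 * P ^+ 4 - 292 * P ^+ 2 + 308 /\
        M2 = 154 * P ^+ 4 - 308 * P ^+ 2 + 308,
      #|G| = (4 * p ^ 2)%N ->
        M1 = 154 * P ^+ 8 - 308 * P ^+ 6 + 324 * P ^+ 4 - 308 * P ^+ 2 + 308 /\
        M2 = 154 * P ^+ 8 - 308 * P ^+ 6 + 308 * P ^+ 4 - 308 * P ^+ 2 + 308
    & [\/ #|G| = (2 * p)%N, #|G| = (2 * p ^ 2)%N,
          #|G| = (4 * p)%N | #|G| = (4 * p ^ 2)%N] ->
        (zagreb2 B)%:R / #|edges B|%:R >= (zagreb1 B)%:R / #|B|%:R :> rat].
Proof.
move=> B M1 M2 P.
have two_p : 2 != p by apply: contraTneq p_odd => <-.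
pose F := pairs_of_order gT G.
have hF : square_divisor_sums F #|G| := pairs_of_order_divisor_sums _ _ cycG.
have M1E : M1 = #|G|%:Z ^+ 2 + M2.
  by rewrite /M1 /M2 zagreb1E zagreb2E -!natz natrD natrX.
have M2E a b : #|G| = (2 ^ a * p ^ b)%N ->
    M2 = (\sum_(i < a.+1) F (2 ^ i) ^ 2)%N%:Z *
         (\sum_(j < b.+1) F (p ^ j) ^ 2)%N%:Z.
  move=> Gn; rewrite /M2 zagreb2E.
  by rewrite (sum_generating_pairs_sqr_pfactor2 _ _ cycG _ _ _ _ Gn).
have S1 q := sum_sqr_jordan_prime F _ q hF.
have S2 q := sum_sqr_jordan_prime_sqr F _ q hF.
have PoszX2 : (p ^ 2)%N%:Z = P ^+ 2 by rewrite -natz natrX natz.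
have dvd2 a b : #|G| = (2 ^ a * p ^ b)%N -> (2 ^ a %| #|G|)%N.
  by move=> ->; apply: dvdn_mulr.
have dvdp a b : #|G| = (2 ^ a * p ^ b)%N -> (p ^ b %| #|G|)%N.
  by move=> ->; apply: dvdn_mull.
split=> [Gn|Gn|Gn|Gn|_]; last exact: zagreb_ratio_leq.
- have GZ : #|G|%:Z = 2 * P by rewrite Gn /P; lia.
  rewrite M1E GZ (M2E 1%N 1%N Gn).
  rewrite (S1 2%N isT (dvd2 1%N 1%N Gn)) (S1 p p_prime (dvdp 1%N 1%N Gn)).
  by split; ring.
- have GZ : #|G|%:Z = 2 * P ^+ 2 by rewrite Gn -PoszX2; lia.
  rewrite M1E GZ (M2E 1%N 2%N Gn).
  rewrite (S1 2%N isT (dvd2 1%N 2%N Gn)) (S2 p p_prime (dvdp 1%N 2%N Gn)).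
  by split; ring.
- have GZ : #|G|%:Z = 4 * P by rewrite Gn /P; lia.
  rewrite M1E GZ (M2E 2%N 1%N Gn).
  rewrite (S2 2%N isT (dvd2 2%N 1%N Gn)) (S1 p p_prime (dvdp 2%N 1%N Gn)).
  by split; ring.
- have GZ : #|G|%:Z = 4 * P ^+ 2 by rewrite Gn -PoszX2; lia.
  rewrite M1E GZ (M2E 2%N 2%N Gn).
  rewrite (S2 2%N isT (dvd2 2%N 2%N Gn)) (S2 p p_prime (dvdp 2%N 2%N Gn)).
  by split; ring.
Qed.
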